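(* For all positive integers $m$ and $k$, the grid $P_m\,\square\,P_k$ is stackable.
   Context: $P_n$ is the path on $n$ vertices and $\square$ denotes the Cartesian product of graphs. A configuration is a function $C:V(G)\to\mathbb{N}$ (numbers of cups). A cup stacking move from $u$ to $v$ is allowed when $C(u)\ge1$, $C(v)\ge1$ and $\mathrm{dist}_G(u,v)=C(u)$; it moves all cups of $u$ onto $v$. Let $\mathbf{1}$ be the configuration with one cup on every vertex. $G$ is $r$-stackable if some sequence of moves from $\mathbf{1}$ puts all cups on $r$, and stackable if it is $r$-stackable for every vertex $r$. *)

(* Defs.v *)
From Stdlib Require Import Relation_Operators.
From mathcomp Require Import all_boot.
Set Implicit Arguments.
Unset Strict Implicit.
Unset Printing Implicit Defensive.

(** Finite simple graphs *)

Record sgraph := SGraph {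
  vertex :> finType;
  adj : rel vertex;
  adj_sym : symmetric adj;
  adj_irrefl : irreflexive adj }.

Definition path_adj (n : nat) : rel 'I_n :=
  fun i j => (i.+1 == j :> nat) || (j.+1 == i :> nat).

Lemma path_adj_sym n : symmetric (@path_adj n).
Proof. by move=> i j; rewrite /path_adj orbC. Qed.

Lemma path_adj_irrefl n : irreflexive (@path_adj n).
Proof. by move=> i; rewrite /path_adj orbb gtn_eqF. Qed.

Definition path_graph (n : nat) : sgraph :=
  SGraph (@path_adj_sym n) (@path_adj_irrefl n).

Definition cart_adj (G H : sgraph) : rel (G * H) :=
  fun x y => ((x.1 == y.1) && adj x.2 y.2) || ((x.2 == y.2) && adj x.1 y.1).

Lemma cart_adj_sym (G H : sgraph) : symmetric (@cart_adj G H).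
Proof.
move=> x y; rewrite /cart_adj (eq_sym y.1) (eq_sym y.2).
by rewrite (adj_sym y.1) (adj_sym y.2).
Qed.

Lemma cart_adj_irrefl (G H : sgraph) : irreflexive (@cart_adj G H).
Proof. by move=> x; rewrite /cart_adj !adj_irrefl !andbF. Qed.

Definition cart_prod (G H : sgraph) : sgraph :=
  SGraph (@cart_adj_sym G H) (@cart_adj_irrefl G H).

Definition walk (G : sgraph) (u v : G) (d : nat) : Prop :=
  exists p : seq G, [/\ path (@adj G) u p, last u p = v & size p = d].

(* The distance as a relation; no [d] satisfies it when [u] and [v] lie in
   different components, where the distance is infinite. *)
Definition is_dist (G : sgraph) (u v : G) (d : nat) : Prop :=
  walk u v d /\ forall d', walk u v d' -> d <= d'.

(** Cup stacking *)

Definition config (G : sgraph) := {ffun G -> nat}.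

Definition ones (G : sgraph) : config G := [ffun=> 1].

Definition move_cups (G : sgraph) (u v : G) (C : config G) : config G :=
  [ffun w => if w == u then 0 else if w == v then C v + C u else C w].

(* [is_dist u v (C u)] together with [1 <= C u] excludes [u = v]. *)
Definition cup_move (G : sgraph) (C C' : config G) : Prop :=
  exists u v : G, [/\ 1 <= C u, 1 <= C v, is_dist u v (C u)
                    & C' = move_cups u v C].

Definition stackable_at (G : sgraph) (r : G) : Prop :=
  exists C : config G,
    clos_refl_trans _ (@cup_move G) (ones G) C /\
    forall v : G, v != r -> C v = 0.

Definition stackable (G : sgraph) : Prop := forall r : G, stackable_at r.

(* Main.v *)
(* Call S gatherable on v when the cups of S, one per vertex, can all be moved
   onto v. Disjoint unions of gatherable sets are gatherable, and if S is
   gatherable on u with dist(u, v) = #|S| + 1, then u |: S is gatherable on v.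
   By induction a geodesic can be stacked on one of its ends, hence, splitting
   it there, on any of its vertices; so a geodesic with n vertices, one of which
   is at distance n from v, is gatherable on v. A p x q rectangle whose cell
   (x, y) is at distance 1 + x + y from v is a union of such lines, parallel to
   its longer side. Four of these rectangles, in a pinwheel, cover the grid
   minus v. *)
From Stdlib Require Import Relation_Operators.
Require Import Defs.
From mathcomp Require Import all_boot.
From mathcomp Require Import zify.

Set Implicit Arguments.
Unset Strict Implicit.
Unset Printing Implicit Defensive.

(** * Distances in paths and in Cartesian products *)

(** Truncated subtraction makes one of the two terms zero, so this is |i - j|. *)
Definition distn (i j : nat) : nat := (i - j) + (j - i).

Lemma walk0 (G : sgraph) (u : G) : walk u u 0.
Proof. by exists [::]. Qed.

Lemma walk_step (G : sgraph) (u w v : G) d :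
  adj u w -> walk w v d -> walk u v d.+1.
Proof. by move=> uw [p [pP <- <-]]; exists (w :: p); rewrite /= uw. Qed.

Lemma walk_cat (G : sgraph) (u w v : G) d e :
  walk u w d -> walk w v e -> walk u v (d + e).
Proof.
move=> [p [pP <- <-]] [q [qP <- <-]]; exists (p ++ q).
by rewrite cat_path pP last_cat size_cat.
Qed.

Lemma is_dist_refl_eq0 (G : sgraph) (u : G) d : is_dist u u d -> d = 0.
Proof. by case=> _ /(_ 0 (walk0 u)); rewrite leqn0 => /eqP. Qed.

Lemma path_walk n d (i j : 'I_n) :
  distn i j = d -> @walk (path_graph n) i j d.
Proof.
rewrite /distn; elim: d i => [|d IHd] i dij.
  by have -> : i = j by [apply: val_inj => /=; lia]; apply: walk0.
have [ij|ji|ij] := ltngtP i j; last by lia.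
- have lt_i1 : i.+1 < n by apply: leq_ltn_trans ij _.
  apply: (@walk_step _ _ (Ordinal lt_i1 : path_graph n)); last by apply: IHd => /=; lia.
  by rewrite /= /path_adj eqxx.
- have lt_i1 : i.-1 < n by apply: leq_ltn_trans (leq_pred _) (ltn_ord i).
  apply: (@walk_step _ _ (Ordinal lt_i1 : path_graph n)); last by apply: IHd => /=; lia.
  by rewrite /= /path_adj /= prednK ?eqxx ?orbT //; lia.
Qed.

Lemma path_dist n (i j : path_graph n) : is_dist i j (distn i j).
Proof.
split=> [|d [p [pP <- <-]]]; first exact: path_walk.
(* Lower bound: an edge changes the index by one, so it brings a walk at most one step closer to its
   endpoint. *)
elim: p i pP => [|w p IHp] i /=; first by rewrite /distn; lia.
move=> /andP[iw /IHp]; move: iw; rewrite /= /path_adj /distn; lia.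
Qed.

Section Product.

Variables G H : sgraph.

Lemma cart_walk_fst (a b : G) (x : H) d :
  walk a b d -> @walk (cart_prod G H) (a, x) (b, x) d.
Proof.
case=> p [pP <- <-]; exists [seq (c, x) | c <- p]; rewrite size_map; split=> //.
  elim: p a pP => //= c p IHp a /andP[ac /IHp ->].
  by rewrite /cart_adj /= eqxx ac orbT.
by rewrite (last_map (fun c => (c, x))).
Qed.

Lemma cart_walk_snd (a : G) (x y : H) d :
  walk x y d -> @walk (cart_prod G H) (a, x) (a, y) d.
Proof.
case=> p [pP <- <-]; exists [seq (a, c) | c <- p]; rewrite size_map; split=> //.
  elim: p x pP => //= c p IHp x /andP[xc /IHp ->].
  by rewrite /cart_adj /= eqxx xc.
by rewrite (last_map (fun c => (a, c))).
Qed.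

(** An edge of the product changes exactly one coordinate, so the edges of a walk are shared out
    between its two projections. This yields the lower bound on distances in the product. *)
Lemma cart_walk_proj (u v : cart_prod G H) d :
  walk u v d ->
  exists d1 d2, [/\ walk u.1 v.1 d1, walk u.2 v.2 d2 & d = d1 + d2].
Proof.
case=> p [pP <- <-]; elim: p u pP => [|w p IHp] u /=.
  by exists 0, 0; split=> //; apply: walk0.
move=> /andP[/orP[] /andP[/eqP uw1 uw2] /IHp[d1 [d2 [w1 w2 ->]]]].
- by exists d1, d2.+1; rewrite addnS uw1; split=> //; apply: walk_step w2.
- by exists d1.+1, d2; rewrite addSn uw1; split=> //; apply: walk_step w1.
Qed.

Lemma cart_dist (u v : cart_prod G H) d1 d2 :
  is_dist u.1 v.1 d1 -> is_dist u.2 v.2 d2 -> is_dist u v (d1 + d2).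
Proof.
case: u v => [a x] [b y] /= [ab min_ab] [xy min_xy]; split.
  by apply: walk_cat (cart_walk_fst x ab) (cart_walk_snd b xy).
by move=> d /cart_walk_proj /= [e1 [e2 [/min_ab ? /min_xy ? ->]]]; apply: leq_add.
Qed.

End Product.

(** * Gathering sets of single cups on a vertex *)

Section Gather.

Variable G : sgraph.
Implicit Types (u v w : G) (A B S : {set G}) (C : config G).

Notation reach := (clos_refl_trans _ (@cup_move G)).

Definition gathered v S C : config G :=
  [ffun w => if w \in S then 0 else if w == v then C v + #|S| else C w].

(** Off [S] the configuration is arbitrary, apart from a cup on [v] to land on, and only [v] changes
    there; this allows gatherings to be carried out one after the other. *)
Definition gatherable v S : Prop :=
  v \notin S /\
  forall C, (forall w, w \in S -> C w = 1) -> 0 < C v ->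
    reach C (gathered v S C).

Lemma gatherable0 v : gatherable v set0.
Proof.
split=> [|C _ _]; first by rewrite inE.
suff -> : gathered v set0 C = C by apply: rt_refl.
apply/ffunP=> w; rewrite ffunE inE cards0 addn0.
by case: eqP => [->|].
Qed.

(** Gathering [A] leaves the cups of [B] untouched and only adds cups to [v], so [B] can be gathered
    next. *)
Lemma gatherableU v A B :
  [disjoint A & B] -> gatherable v A -> gatherable v B -> gatherable v (A :|: B).
Proof.
move=> dAB [vA gA] [vB gB]; split=> [|C C1 Cv].
  by rewrite inE negb_or vA.
apply: (@rt_trans _ _ _ (gathered v A C)).
  by apply: gA => // w wA; apply: C1; rewrite inE wA.
suff -> : gathered v (A :|: B) C = gathered v B (gathered v A C).
  apply: gB => [w wB|]; rewrite ffunE.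
    rewrite (disjointFl dAB wB); case: eqP => [wv|_].
      by move: vB; rewrite -wv wB.
    by apply: C1; rewrite inE wB orbT.
  by rewrite (negPf vA) eqxx addn_gt0 Cv.
apply/ffunP=> w; rewrite !ffunE inE eqxx (negPf vA).
have -> : #|A :|: B| = #|A| + #|B|.
  by apply/eqP; rewrite (leq_card_setU A B).
case: eqP => [->|_]; first by rewrite (negPf vA) (negPf vB) addnA.
by case: (w \in A); case: (w \in B).
Qed.

Lemma gatherable_bigcup v n (F : 'I_n -> {set G}) :
  (forall i j, i != j -> [disjoint F i & F j]) ->
  (forall i, gatherable v (F i)) -> gatherable v (\bigcup_i F i).
Proof.
elim: n F => [|n IHn] F dF gF; first by rewrite big_ord0; apply: gatherable0.
rewrite big_ord_recl; apply: gatherableU => //.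
  by apply: bigcup_disjoint => i _; apply: dF.
apply: IHn => [i j ij|i //]; apply: dF.
by rewrite (inj_eq lift_inj).
Qed.

(** Gathering [S] on [u] makes a stack of [#|S|.+1] cups there, exactly the distance to [v]. *)
Lemma gatherable_jump u v S :
  gatherable u S -> v \notin u |: S -> is_dist u v #|S|.+1 ->
  gatherable v (u |: S).
Proof.
move=> [uS gS] vuS duv; split=> // C C1 Cv.
have Cu : C u = 1 by apply: C1; rewrite setU11.
move: vuS; rewrite !inE negb_or => /andP[vu vS].
apply: (@rt_trans _ _ _ (gathered u S C)).
  by apply: gS => [w wS|]; [apply: C1; rewrite inE wS orbT | rewrite Cu].
apply: rt_step; exists u, v; rewrite !ffunE (negPf uS) (negPf vS) (negPf vu) eqxx Cu.
split=> //; apply/ffunP=> w; rewrite !ffunE !inE cardsU1 uS (negPf vS) (negPf vu).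
rewrite eqxx (negPf uS) Cu; case: (w =P u) => //= wu.
by case: (w =P v) => [->|//]; rewrite (negPf vS).
Qed.

(** * Geodesic lines *)

Definition geodesic (f : nat -> G) n : Prop :=
  forall i j, i < n -> j < n -> is_dist (f i) (f j) (distn i j).

Definition trace (f : nat -> G) n : {set G} := [set f i | i : 'I_n].

Lemma traceP f n w : reflect (exists2 i, i < n & w = f i) (w \in trace f n).
Proof.
apply: (iffP imsetP) => [[i _ ->]|[i lt_in ->]]; first by exists i.
by exists (Ordinal lt_in).
Qed.

Lemma geodesic_inj f n i j :
  geodesic f n -> i < n -> j < n -> f i = f j -> i = j.
Proof.
move=> gf lt_i lt_j fij; have := gf _ _ lt_i lt_j.
by rewrite fij => /is_dist_refl_eq0; rewrite /distn; lia.
Qed.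

Lemma card_trace f n : geodesic f n -> #|trace f n| = n.
Proof.
move=> gf; rewrite card_imset ?card_ord // => i j fij.
by apply: val_inj; apply: geodesic_inj gf _ _ fij.
Qed.

Lemma geodesic_leq f n p : p <= n -> geodesic f n -> geodesic f p.
Proof. by move=> le_pn gf i j lt_i lt_j; apply: gf; lia. Qed.

Lemma geodesic_rev f n p :
  p <= n.+1 -> geodesic f n.+1 -> geodesic (fun i => f (n - i)) p.
Proof.
move=> le_pn gf i j lt_i lt_j.
have -> : distn i j = distn (n - i) (n - j) by rewrite /distn; lia.
by apply: gf; lia.
Qed.

(* The segment without its first cell gathers on that cell from its far end;
   the whole stack then jumps to [v]. *)
Lemma gatherable_end f n v :
  geodesic f n -> v \notin trace f n -> is_dist (f 0) v n ->
  gatherable v (trace f n).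
Proof.
elim: n f v => [|n IHn] f v gf vf dv.
  have -> : trace f 0 = set0 by apply/setP=> w; rewrite inE; apply/traceP; case.
  exact: gatherable0.
pose g i := f (n - i).
have gg : geodesic g n by apply: geodesic_rev gf.
have def_f : trace f n.+1 = f 0 |: trace g n.
  apply/setP=> w; rewrite !inE; apply/traceP/orP => [[[|i] lt_i ->]|].
  - by left.
  - by right; apply/traceP; exists (n - i.+1); rewrite /g; [|congr f]; lia.
  - by case=> [/eqP->|/traceP[i lt_i ->]]; [exists 0|exists (n - i); first lia].
rewrite def_f; apply: gatherable_jump; rewrite -?def_f ?card_trace //.
apply: IHn => //.
  apply/traceP => -[i lt_i fi]; suff : 0 = n - i by lia.
  by apply: geodesic_inj gf _ _ fi; lia.
have := gf n 0; rewrite /g subn0 /distn; rewrite sub0n subn0 addn0.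
by apply.
Qed.

Lemma gatherable_line f n t v :
  geodesic f n -> v \notin trace f n -> t < n -> is_dist (f t) v n ->
  gatherable v (trace f n).
Proof.
case: n => // n gf vf le_tn dv; pose g i := f (n - i).
have gl : geodesic f t by apply: geodesic_leq gf; lia.
have gr : geodesic g (n - t) by apply: geodesic_rev gf; lia.
have def_f : trace f n.+1 = f t |: (trace f t :|: trace g (n - t)).
  apply/setP=> w; rewrite !inE; apply/traceP/or3P => [[i lt_i ->]|].
    have [it|ti|->] := ltngtP i t; last by constructor 1.
      by constructor 2; apply/traceP; exists i.
    by constructor 3; apply/traceP; exists (n - i); rewrite /g; [|congr f]; lia.
  case=> [/eqP->|/traceP[i lt_i ->]|/traceP[i lt_i ->]].
  - by exists t.
  - by exists i; first lia.
  - by exists (n - i); first lia.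
have dlr : [disjoint trace f t & trace g (n - t)].
  rewrite -setI_eq0; apply/eqP/setP=> w; rewrite !inE; apply/negP.
  case/andP=> /traceP[i lt_i ->] /traceP[j lt_j /(geodesic_inj gf)].
  by lia.
(* Each arm is gathered on [f t] from its far end, [f 0] or [f n], whose distance to [f t] is the
   number of cells of the arm. *)
have glr : gatherable (f t) (trace f t :|: trace g (n - t)).
  apply: gatherableU => //; apply: gatherable_end => //.
  - by apply/traceP => -[i lt_i /(geodesic_inj gf)]; lia.
  - by have := gf 0 t; rewrite /distn subn0 sub0n; apply; lia.
  - by apply/traceP => -[i lt_i /(geodesic_inj gf)]; lia.
  - have := gf n t; rewrite /g subn0 /distn.
    have -> : n - t + (t - n) = n - t by lia.
    by apply; lia.
rewrite def_f; apply: gatherable_jump; rewrite -?def_f //.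
suff -> : #|trace f t :|: trace g (n - t)| = n by [].
have := card_trace gf; rewrite def_f cardsU1; case: glr => -> _ /=; lia.
Qed.

(** * Rectangles *)

(** An isometric embedding of the [p] by [q] grid with its l1 metric. *)
Definition grid_dist (h : nat -> nat -> G) p q : Prop :=
  forall x y x' y', x < p -> y < q -> x' < p -> y' < q ->
    is_dist (h x y) (h x' y') (distn x x' + distn y y').

(* The [x]-th line has [q] cells, at distances [x.+1, ..., x + q] from [r];
   as [x < p <= q], one of these distances is [q]. *)
Lemma gatherable_wide_rect (h : nat -> nat -> G) p q r :
  p <= q -> grid_dist h p q ->
  (forall x y, x < p -> y < q -> is_dist (h x y) r (x + y).+1) ->
  gatherable r (\bigcup_(x < p) trace (h x) q).
Proof.
move=> le_pq gh dr; apply: gatherable_bigcup => [x x' xx'|x].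
  rewrite -setI_eq0; apply/eqP/setP=> w; rewrite !inE; apply/negP.
  case/andP=> /traceP[y lt_y ->] /traceP[y' lt_y' hh].
  have := gh _ _ _ _ (ltn_ord x) lt_y (ltn_ord x') lt_y'.
  rewrite hh => /is_dist_refl_eq0; move: xx'; rewrite -val_eqE /= /distn; lia.
have lt_x := ltn_ord x.
apply: (@gatherable_line _ _ (q - x.+1)).
- by move=> y y' lt_y lt_y'; have := gh x y x y'; rewrite {1}/distn subnn; apply.
- apply/traceP=> -[y lt_y rh]; have := dr x y lt_x lt_y.
  by rewrite -rh => /is_dist_refl_eq0.
- by lia.
- have := dr x (q - x.+1) lt_x.
  have -> : (x + (q - x.+1)).+1 = q by lia.
  by apply; lia.
Qed.

(** The hypotheses are symmetric in [x] and [y], so the lines can be taken along the longer side,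
    whichever it is; both choices cover the same [R]. *)
Lemma gatherable_rect (h : nat -> nat -> G) p q r (R : {set G}) :
  grid_dist h p q ->
  (forall x y, x < p -> y < q -> is_dist (h x y) r (x + y).+1) ->
  (forall x y, x < p -> y < q -> h x y \in R) ->
  (forall w, w \in R -> exists x y, [/\ x < p, y < q & w = h x y]) ->
  gatherable r R.
Proof.
move=> gh dr hR Rh; have [le_pq|/ltnW le_qp] := leqP p q.
  suff -> : R = \bigcup_(x < p) trace (h x) q by apply: gatherable_wide_rect.
  apply/setP=> w; apply/idP/bigcupP => [/Rh[x [y [lt_x lt_y ->]]]|].
    by exists (Ordinal lt_x) => //; apply/traceP; exists y.
  by case=> x _ /traceP[y lt_y ->]; apply: hR.
suff -> : R = \bigcup_(y < q) trace (fun x => h x y) p.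
  apply: (@gatherable_wide_rect (fun y x => h x y)) => //.
    by move=> y x y' x' *; rewrite addnC; apply: gh.
  by move=> y x *; rewrite addnC; apply: dr.
apply/setP=> w; apply/idP/bigcupP => [/Rh[x [y [lt_x lt_y ->]]]|].
  by exists (Ordinal lt_y) => //; apply/traceP; exists x.
by case=> y _ /traceP[x lt_x ->]; apply: hR.
Qed.

Lemma gatherable_stackable r : gatherable r [set~ r] -> stackable_at r.
Proof.
case=> _ gr; exists (gathered r [set~ r] (ones G)); split.
  by apply: gr => [w _|]; rewrite ffunE.
by move=> v vr; rewrite ffunE !inE vr.
Qed.

End Gather.

(** * The pinwheel decomposition of the grid *)

Theorem theorem7 (m k : nat) (hm : 0 < m) (hk : 0 < k) :
  stackable (cart_prod (path_graph m) (path_graph k)).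
Proof.
case: m k hm hk => [//|m] [//|k] _ _.
set G := cart_prod _ _; case=> i j; apply: gatherable_stackable.
(* A pinwheel around [r = (i, j)]: each rectangle has a corner next to [r] and
   contains one of the four half-lines issued from [r]. *)
have lt_i := ltn_ord i; have lt_j := ltn_ord j.
have dG (u v : G) d : d = distn u.1 v.1 + distn u.2 v.2 -> is_dist u v d.
  by move=> ->; apply: cart_dist; apply: path_dist.
(* [inord] falls back on 0 out of range; [c] is only used for [a <= m] and [b <= k]. *)
pose c a b : G := (inord a, inord b).
have cE (w : G) a b : w.1 = a :> nat -> w.2 = b :> nat -> w = c a b.
  by case: w => w1 w2 /= <- <-; rewrite /c !inord_val.
(* The weak inequality of each set takes in one half-line, and the strict one leaves the next
   half-line to another set, so the four sets are disjoint. *)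
pose R1 : {set G} := [set w : G | (i < w.1) && (j <= w.2)].
pose R2 : {set G} := [set w : G | (w.1 <= i) && (j < w.2)].
pose R3 : {set G} := [set w : G | (w.1 < i) && (w.2 <= j)].
pose R4 : {set G} := [set w : G | (i <= w.1) && (w.2 < j)].
have -> : [set~ ((i, j) : G)] = R1 :|: R2 :|: (R3 :|: R4).
  apply/setP=> -[a b]; rewrite !inE xpair_eqE -!val_eqE /=; lia.
have dis (A B : {set G}) : (forall w, w \in A -> w \in B -> False) -> [disjoint A & B].
  move=> AB; rewrite -setI_eq0; apply/eqP/setP=> w; rewrite !inE.
  by apply/negP=> /andP[]; apply: AB.
have g1 : gatherable ((i, j) : G) R1.
  (* In all four cases [x] runs in the direction of the strict inequality, hence the shift by one,
     and [y] in that of the weak one; the cell is then [x.+1 + y] away from [(i, j)]. *)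
  apply: (@gatherable_rect _ (fun x y => c (i + x.+1) (j + y)) (m - i) (k.+1 - j)).
  - by move=> x y x' y' *; apply: dG; rewrite /= !inordK /distn; lia.
  - by move=> x y *; apply: dG; rewrite /= !inordK /distn; lia.
  - by move=> x y *; rewrite inE /= !inordK; lia.
  - move=> w; have := ltn_ord w.1; have := ltn_ord w.2; rewrite inE => *.
    by exists (w.1 - i.+1), (w.2 - j); split; try apply: cE; lia.
have g2 : gatherable ((i, j) : G) R2.
  apply: (@gatherable_rect _ (fun x y => c (i - y) (j + x.+1)) (k - j) i.+1).
  - by move=> x y x' y' *; apply: dG; rewrite /= !inordK /distn; lia.
  - by move=> x y *; apply: dG; rewrite /= !inordK /distn; lia.
  - by move=> x y *; rewrite inE /= !inordK; lia.
  - move=> w; have := ltn_ord w.1; have := ltn_ord w.2; rewrite inE => *.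
    by exists (w.2 - j.+1), (i - w.1); split; try apply: cE; lia.
have g3 : gatherable ((i, j) : G) R3.
  apply: (@gatherable_rect _ (fun x y => c (i - x.+1) (j - y)) i j.+1).
  - by move=> x y x' y' *; apply: dG; rewrite /= !inordK /distn; lia.
  - by move=> x y *; apply: dG; rewrite /= !inordK /distn; lia.
  - by move=> x y *; rewrite inE /= !inordK; lia.
  - move=> w; have := ltn_ord w.1; have := ltn_ord w.2; rewrite inE => *.
    by exists (i - w.1.+1), (j - w.2); split; try apply: cE; lia.
have g4 : gatherable ((i, j) : G) R4.
  apply: (@gatherable_rect _ (fun x y => c (i + y) (j - x.+1)) j (m.+1 - i)).
  - by move=> x y x' y' *; apply: dG; rewrite /= !inordK /distn; lia.
  - by move=> x y *; apply: dG; rewrite /= !inordK /distn; lia.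
  - by move=> x y *; rewrite inE /= !inordK; lia.
  - move=> w; have := ltn_ord w.1; have := ltn_ord w.2; rewrite inE => *.
    by exists (j - w.2.+1), (w.1 - i); split; try apply: cE; lia.
have g12 : gatherable ((i, j) : G) (R1 :|: R2).
  by apply: gatherableU => //; apply: dis => w; rewrite !inE; lia.
have g34 : gatherable ((i, j) : G) (R3 :|: R4).
  by apply: gatherableU => //; apply: dis => w; rewrite !inE; lia.
by apply: gatherableU => //; apply: dis => w; rewrite !inE; lia.
Qed.
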